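(* Let $p$ be an even positive integer and $\varepsilon \in (0,1)$. Given a dataset $X\subset \mathbb{R}^d$ of $n$ non-negative $s$-sparse vectors, one can compute (with randomness) a data structure $\mathcal{D}$ in $O(n\log(n)ps/\varepsilon^2)$ preprocessing time such that for any fixed non-negative $s$-sparse query $y \in \mathbb{R}^d$ (chosen independently of the randomness of $\mathcal{D}$), $\mathcal{D}$ computes in $O(\log(n)ps/\varepsilon^2)$ time a value $t$ satisfying \[ \left | t - \sum_{x \in X} \|x - y\|_p^p \right| \le \varepsilon \cdot \sum_{x \in X} \|x - y\|_p^p \] with probability at least $1-1/\mathrm{poly}(n)$.
   Context: A vector is $s$-sparse if it has at most $s$ non-zero coordinates; non-negative means all coordinates are $\ge 0$. ''With probability at least $1-1/\mathrm{poly}(n)$'' means at least $1-n^{-c}$ for some constant $c>0$. *)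

(* Defs.v *)
From HB Require Import structures.
From mathcomp Require Import all_boot all_order all_algebra.
From mathcomp Require Import reals exp.

Set Implicit Arguments.
Unset Strict Implicit.
Unset Printing Implicit Defensive.

Import Order.TTheory GRing.Theory Num.Theory.
Local Open Scope ring_scope.

(* Vectors *)

Definition supp (R : realType) (d : nat) (v : 'rV[R]_d) : seq 'I_d :=
  [seq j <- enum 'I_d | v 0 j != 0].

Definition sparse (R : realType) (d s : nat) (v : 'rV[R]_d) : Prop :=
  (size (supp v) <= s)%N.

Definition nonneg (R : realType) (d : nat) (v : 'rV[R]_d) : Prop :=
  forall j : 'I_d, 0 <= v 0 j.

Definition pnorm (R : realType) (d p : nat) (v : 'rV[R]_d) : R :=
  (\sum_(j < d) `|v 0 j| ^+ p) `^ (p%:R^-1).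

(* The model of computation is a word RAM extended with exact real
   arithmetic, presented as a structured imperative language.  Integer
   cells hold w-bit words and integer arithmetic is modulo 2 ^ w.  Real
   cells hold elements of R.  Words may be cast to reals, but there is no
   rounding: reals influence words only through comparisons.  A program
   uses finitely many variables and arrays, named by natural numbers that
   are fixed in its text; arrays are indexed by computed words.  The only
   literals are natural numbers. *)

Inductive iexp : Type :=
| ILit of nat
| IVar of nat
| IGet of nat & iexp
| IAdd of iexp & iexp
| ISub of iexp & iexp
| IMul of iexp & iexp
| IDiv of iexp & iexp
| IMod of iexp & iexp.

Inductive rexp : Type :=
| RVar of nat
| RGet of nat & iexp
| RCast of iexp
| RAdd of rexp & rexp
| RSub of rexp & rexp
| RMul of rexp & rexp
| RDiv of rexp & rexp.

Inductive bexp : Type :=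
| BIEq of iexp & iexp
| BILt of iexp & iexp
| BREq of rexp & rexp
| BRLt of rexp & rexp
| BNot of bexp
| BAnd of bexp & bexp.

Inductive cmd : Type :=
| CSkip
| CSetI of nat & iexp
| CSetR of nat & rexp
| CPutI of nat & iexp & iexp           (* array, index, value *)
| CPutR of nat & iexp & rexp
| CRand of nat                         (* draws a uniformly random word *)
| CSeq of cmd & cmd
| CIf of bexp & cmd & cmd
| CWhile of bexp & cmd.

(* [tape] is the sequence of random words that have not been drawn yet. *)
Record store (R : realType) : Type := Store {
  ivar : nat -> nat;
  rvar : nat -> R;
  iarr : nat -> nat -> nat;
  rarr : nat -> nat -> R;
  tape : seq nat }.

Definition upd (T : Type) (f : nat -> T) (i : nat) (v : T) : nat -> T :=
  fun j => if j == i then v else f j.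

Definition upd2 (T : Type) (f : nat -> nat -> T) (a i : nat) (v : T) :
  nat -> nat -> T := upd f a (upd (f a) i v).

Definition set_ivar (R : realType) (st : store R) (x v : nat) : store R :=
  Store (upd (ivar st) x v) (rvar st) (iarr st) (rarr st) (tape st).

Definition set_rvar (R : realType) (st : store R) (x : nat) (v : R) :
  store R :=
  Store (ivar st) (upd (rvar st) x v) (iarr st) (rarr st) (tape st).

Definition set_iarr (R : realType) (st : store R) (a i v : nat) : store R :=
  Store (ivar st) (rvar st) (upd2 (iarr st) a i v) (rarr st) (tape st).

Definition set_rarr (R : realType) (st : store R) (a i : nat) (v : R) :
  store R :=
  Store (ivar st) (rvar st) (iarr st) (upd2 (rarr st) a i v) (tape st).

Definition set_tape (R : realType) (st : store R) (r : seq nat) : store R :=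
  Store (ivar st) (rvar st) (iarr st) (rarr st) r.

Fixpoint ieval (R : realType) (w : nat) (st : store R) (e : iexp) : nat :=
  match e with
  | ILit c => (c %% 2 ^ w)%N
  | IVar x => ivar st x
  | IGet a e1 => iarr st a (ieval w st e1)
  | IAdd e1 e2 => ((ieval w st e1 + ieval w st e2) %% 2 ^ w)%N
  | ISub e1 e2 => ((ieval w st e1 + 2 ^ w - ieval w st e2) %% 2 ^ w)%N
  | IMul e1 e2 => ((ieval w st e1 * ieval w st e2) %% 2 ^ w)%N
  | IDiv e1 e2 => (ieval w st e1 %/ ieval w st e2)%N
  | IMod e1 e2 => (ieval w st e1 %% ieval w st e2)%N
  end.

Fixpoint reval (R : realType) (w : nat) (st : store R) (e : rexp) : R :=
  match e with
  | RVar x => rvar st x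
  | RGet a e1 => rarr st a (ieval w st e1)
  | RCast e1 => (ieval w st e1)%:R
  | RAdd e1 e2 => reval w st e1 + reval w st e2
  | RSub e1 e2 => reval w st e1 - reval w st e2
  | RMul e1 e2 => reval w st e1 * reval w st e2
  | RDiv e1 e2 => reval w st e1 / reval w st e2
  end.

Fixpoint beval (R : realType) (w : nat) (st : store R) (b : bexp) : bool :=
  match b with
  | BIEq e1 e2 => ieval w st e1 == ieval w st e2
  | BILt e1 e2 => (ieval w st e1 < ieval w st e2)%N
  | BREq e1 e2 => reval w st e1 == reval w st e2
  | BRLt e1 e2 => reval w st e1 < reval w st e2
  | BNot b1 => ~~ beval w st b1
  | BAnd b1 b2 => beval w st b1 && beval w st b2
  end.

(* Every operation, literal and memory access takes unit time. *)

Fixpoint icost (e : iexp) : nat :=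
  match e with
  | ILit _ | IVar _ => 1%N
  | IGet _ e1 => (icost e1).+1
  | IAdd e1 e2 | ISub e1 e2 | IMul e1 e2 | IDiv e1 e2 | IMod e1 e2 =>
      (icost e1 + icost e2).+1
  end.

Fixpoint rcost (e : rexp) : nat :=
  match e with
  | RVar _ => 1%N
  | RGet _ e1 | RCast e1 => (icost e1).+1
  | RAdd e1 e2 | RSub e1 e2 | RMul e1 e2 | RDiv e1 e2 =>
      (rcost e1 + rcost e2).+1
  end.

Fixpoint bcost (b : bexp) : nat :=
  match b with
  | BIEq e1 e2 | BILt e1 e2 => (icost e1 + icost e2).+1
  | BREq e1 e2 | BRLt e1 e2 => (rcost e1 + rcost e2).+1
  | BNot b1 => (bcost b1).+1
  | BAnd b1 b2 => (bcost b1 + bcost b2).+1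
  end.

(* [exec w c st st' t]: on w-bit words, [c] started in [st] halts in [st']
   after exactly [t] units of time.  Drawing from an empty tape blocks. *)
Inductive exec (R : realType) (w : nat) :
  cmd -> store R -> store R -> nat -> Prop :=
| ESkip st : exec w CSkip st st 1
| ESetI x e st :
    exec w (CSetI x e) st (set_ivar st x (ieval w st e)) (icost e).+1
| ESetR x e st :
    exec w (CSetR x e) st (set_rvar st x (reval w st e)) (rcost e).+1
| EPutI a i e st :
    exec w (CPutI a i e) st
      (set_iarr st a (ieval w st i) (ieval w st e)) (icost i + icost e).+1
| EPutR a i e st :
    exec w (CPutR a i e) st
      (set_rarr st a (ieval w st i) (reval w st e)) (icost i + rcost e).+1
| ERand x u r st : tape st = u :: r ->
    exec w (CRand x) st (set_ivar (set_tape st r) x u) 1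
| ESeq c1 c2 st1 st2 st3 t1 t2 :
    exec w c1 st1 st2 t1 -> exec w c2 st2 st3 t2 ->
    exec w (CSeq c1 c2) st1 st3 (t1 + t2)
| EIfT b c1 c2 st st' t : beval w st b -> exec w c1 st st' t ->
    exec w (CIf b c1 c2) st st' (bcost b + t).+1
| EIfF b c1 c2 st st' t : ~~ beval w st b -> exec w c2 st st' t ->
    exec w (CIf b c1 c2) st st' (bcost b + t).+1
| EWhileF b c st : ~~ beval w st b ->
    exec w (CWhile b c) st st (bcost b).+1
| EWhileT b c st1 st2 st3 t1 t2 : beval w st1 b ->
    exec w c st1 st2 t1 -> exec w (CWhile b c) st2 st3 t2 ->
    exec w (CWhile b c) st1 st3 (bcost b + t1 + t2).+1.

(* A vector is given to a program as the list of its non-zero entries, i.e.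
   two parallel arrays of coordinates and values together with their length.
   Past the end of the list both arrays contain 0. *)

Definition supp_idx (R : realType) (d : nat) (v : 'rV[R]_d) (j : nat) : nat :=
  nth 0%N [seq nat_of_ord i | i <- supp v] j.

Definition supp_val (R : realType) (d : nat) (v : 'rV[R]_d) (j : nat) : R :=
  nth 0 [seq v 0 i | i <- supp v] j.

(* Initial store of the preprocessing: integer variables 0-3 hold n, d, s, p
   and real variable 0 holds eps.  The number of non-zero entries of the k-th
   data vector is at index k of integer array 0; its j-th non-zero entry is
   at index k * s + j of integer array 1 (coordinate) and of real array 0
   (value).  All other cells are 0. *)
Definition init_store (R : realType) (n d s p : nat) (eps : R)
    (X : n.-tuple 'rV[R]_d) (r : seq nat) : store R :=
  Store
    (fun x => nth 0%N [:: n; d; s; p] x)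
    (fun x => if x == 0%N then eps else 0)
    (fun a i => if a == 0%N then size (supp (nth 0 X i))
                else if a == 1%N then supp_idx (nth 0 X (i %/ s)) (i %% s)
                else 0%N)
    (fun a i => if a == 0%N then supp_val (nth 0 X (i %/ s)) (i %% s) else 0)
    r.

(* The data structure is the store left by the preprocessing.  A query y is
   loaded on top of it: its number of non-zero entries in integer variable 4,
   their coordinates in integer array 2 and their values in real array 1.  The
   tape is emptied, so that the query procedure is deterministic and all the
   randomness is that of the data structure. *)
Definition load_query (R : realType) (d : nat) (D : store R) (y : 'rV[R]_d) :
  store R :=
  Store (upd (ivar D) 4 (size (supp y))) (rvar D)
    (upd (iarr D) 2 (supp_idx y)) (upd (rarr D) 1 (supp_val y)) [::].

(* The answer to a query is read in real variable 1. *)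
Definition answer (R : realType) (st : store R) : R := rvar st 1.

(* Tapes of l words of w bits, under the uniform distribution. *)
Definition coins (w l : nat) : finType := l.-tuple 'I_(2 ^ w).

Definition words (w l : nat) (r : coins w l) : seq nat :=
  [seq nat_of_ord u | u <- r : l.-tuple 'I_(2 ^ w)].

Definition unif_prob (R : realType) (T : finType) (E : pred T) : R :=
  #|E|%:R / #|T|%:R.

(* Main.v *)
(* For even p, |x_j - y_j|^p is a polynomial in y_j of degree p, so for each
   coordinate j the sum over X is the polynomial with coefficients
   a_{j,k} = sum_x C(p,k) (-x_j)^(p-k), where a_{j,p} = n.  For k < p a
   non-zero a_{j,k} requires a data vector with x_j <> 0, so the table of the
   a_{j,k} is filled in time O(n p s); it is indexed directly by j p + k < 2^w
   and, memory being zero initially, needs no initialization.  A query starts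
   from sum_j a_{j,0} and adds the terms of positive degree for the j in the
   support of y only.  The answer is exact and no random word is drawn. *)

Require Import Defs.
From HB Require Import structures.
From mathcomp Require Import all_boot all_order all_algebra.
From mathcomp Require Import reals exp.
From mathcomp Require Import boolp zify ring lra.

Set Implicit Arguments.
Unset Strict Implicit.
Unset Printing Implicit Defensive.

Import Order.TTheory GRing.Theory Num.Theory.
Local Open Scope ring_scope.

(** * Expansion of the even power and the resulting formula for the sum *)

Definition shifted_coef (R : realType) (p : nat) (v : R) (k : nat) : R :=
  (- v) ^+ (p - k) *+ 'C(p, k).

Lemma shifted_coefpp (R : realType) (p : nat) (v : R) :
  shifted_coef p v p = 1.
Proof. by rewrite /shifted_coef subnn expr0 binn. Qed.

Lemma shifted_coef_at0 (R : realType) (p k : nat) : (k < p)%N ->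
  shifted_coef p (0 : R) k = 0.
Proof.
by move=> kp; rewrite /shifted_coef oppr0 expr0n subn_eq0 leqNgt kp mul0rn.
Qed.

(** Follows from $(k+1) C(p,k+1) = (p-k) C(p,k)$. Starting from the value 1 at degree $p$ and
    descending, each coefficient costs a constant number of operations, with no binomial or power
    computed separately. *)
Lemma shifted_coefS (R : realType) (p k : nat) (v : R) : (k < p)%N ->
  shifted_coef p v k =
  shifted_coef p v k.+1 * (- v) * k.+1%:R / (p - k)%:R.
Proof.
move=> kp; have pk0 : (p - k)%:R != 0 :> R by rewrite pnatr_eq0 -lt0n subn_gt0.
apply: (mulIf pk0); rewrite divfK // /shifted_coef.
have h : k.+1%:R * 'C(p, k.+1)%:R = (p - k)%:R * 'C(p, k)%:R :> R.
  by rewrite -!natrM mul_bin_left.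
have -> : (- v) ^+ (p - k) = (- v) ^+ (p - k.+1) * - v.
  by rewrite -exprSr subnSK.
rewrite -(mulr_natr _ 'C(p, k)) -(mulr_natr _ 'C(p, k.+1)).
move: h; move: (_ ^+ _) (k.+1%:R : R) ('C(_, k.+1)%:R) ((p - k)%:R) ('C(_, k)%:R).
by move=> a b c e f h; rewrite -!mulrA [f * e]mulrC -h; ring.
Qed.

(** Evenness of $p$ removes the absolute value, and the binomial theorem applies to $(-v+u)^p$. Both
    extreme terms are split off: the constant one does not involve the query, and the leading one
    has coefficient 1 and takes no table cell. *)
Lemma sum_shifted_coef (R : realType) (p : nat) (v u : R) : (0 < p)%N ->
  ~~ odd p ->
  `|v - u| ^+ p =
  shifted_coef p v 0 + \sum_(1 <= k < p) shifted_coef p v k * u ^+ k + u ^+ p.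
Proof.
move=> p0 p_even.
have -> : `|v - u| ^+ p = (- v + u) ^+ p.
  by rewrite -normrX ger0_norm ?exprn_even_ge0 // -opprB exprNn
     -signr_odd (negbTE p_even) mul1r addrC.
rewrite exprDn -(big_mkord xpredT (fun i => ((- v) ^+ (p - i) * u ^+ i) *+ 'C(p, i))).
rewrite big_nat_recr //= binn subnn mul1r mulr1n; congr (_ + _).
rewrite big_ltn // expr0 mulr1; congr (_ + _).
by apply: eq_bigr => k _; rewrite /shifted_coef mulrnAl.
Qed.

Lemma pnormX (R : realType) (d p : nat) (v : 'rV[R]_d) : (0 < p)%N ->
  pnorm p v ^+ p = \sum_(j < d) `|v 0 j| ^+ p.
Proof.
move=> p0; rewrite /pnorm -powR_mulrn ?powR_ge0 // -powRrM mulVf ?powRr1 //.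
  by apply: sumr_ge0 => j _; rewrite exprn_ge0.
by rewrite pnatr_eq0 -lt0n.
Qed.

Lemma big_supp (R : realType) (d : nat) (v : 'rV[R]_d) (F : 'I_d -> R) :
  (forall j, v 0 j = 0 -> F j = 0) ->
  \sum_(j <- supp v) F j = \sum_(j < d) F j.
Proof.
move=> F0; rewrite /supp big_filter [RHS]big_mkcond -big_enum big_mkcond /=.
by apply: eq_bigr => j _; case: eqP => // /F0.
Qed.

Definition table (R : realType) (d p : nat) (X : seq 'rV[R]_d)
    (j : 'I_d) (k : nat) : R :=
  \sum_(x <- X) shifted_coef p (x 0 j) k.

Definition power_total (R : realType) (d p : nat) (X : seq 'rV[R]_d) : R :=
  \sum_(x <- X) \sum_(j < d) shifted_coef p (x 0 j) 0.

Definition query_term (R : realType) (d p : nat) (X : seq 'rV[R]_d)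
    (y : 'rV[R]_d) (j : 'I_d) : R :=
  \sum_(1 <= k < p) table p X j k * y 0 j ^+ k + (size X)%:R * y 0 j ^+ p.

(** After exchanging the sums over vectors and coordinates, every term of positive degree in $y_j$
    vanishes when $y_j = 0$, so only the support of $y$ remains. *)
Lemma sum_pnormX (R : realType) (d p : nat) (X : seq 'rV[R]_d)
    (y : 'rV[R]_d) : (0 < p)%N -> ~~ odd p ->
  \sum_(x <- X) pnorm p (x - y) ^+ p =
  power_total p X + \sum_(j <- supp y) query_term p X y j.
Proof.
move=> p0 p_even; rewrite big_supp; last first.
  move=> j yj0; rewrite /query_term yj0 expr0n gtn_eqF // mulr0 addr0 big_nat big1 // => k /andP[k0 _].
  by rewrite expr0n gtn_eqF // mulr0.
rewrite /power_total exchange_big -big_split /=.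
under eq_bigr => x _ do rewrite pnormX //.
rewrite exchange_big /=; apply: eq_bigr => j _.
under eq_bigr => x _ do rewrite !mxE sum_shifted_coef // -addrA.
rewrite big_split /=; congr (_ + _); rewrite big_split /= /query_term.
congr (_ + _); last by rewrite big_const_seq count_predT iter_addr_0 mulr_natl.
by rewrite exchange_big /=; apply: eq_bigr => k _; rewrite /table mulr_suml.
Qed.

(** * Program logic for total correctness with time budgets *)

Definition runs (R : realType) (w : nat) (c : cmd) (st : store R) (T : nat)
    (Q : store R -> Prop) : Prop :=
  exists st' t, [/\ exec w c st st' t, (t <= T)%N & Q st'].

Lemma runs_weaken (R : realType) w c (st : store R) T T' (Q Q' : _ -> Prop) :
  runs w c st T Q -> (T <= T')%N -> (forall st', Q st' -> Q' st') ->
  runs w c st T' Q'.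
Proof.
move=> [st' [t [e tT q]]] TT' QQ'; exists st', t.
by split=> //; [apply: leq_trans tT TT' | apply: QQ'].
Qed.

Lemma runs_setI (R : realType) w x e (st : store R) (Q : _ -> Prop) :
  Q (set_ivar st x (ieval w st e)) -> runs w (CSetI x e) st (icost e).+1 Q.
Proof. by move=> q; eexists _, _; split; [exact: ESetI | |]. Qed.

Lemma runs_setR (R : realType) w x e (st : store R) (Q : _ -> Prop) :
  Q (set_rvar st x (reval w st e)) -> runs w (CSetR x e) st (rcost e).+1 Q.
Proof. by move=> q; eexists _, _; split; [exact: ESetR | |]. Qed.

Lemma runs_putR (R : realType) w a i e (st : store R) (Q : _ -> Prop) :
  Q (set_rarr st a (ieval w st i) (reval w st e)) ->
  runs w (CPutR a i e) st (icost i + rcost e).+1 Q.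
Proof. by move=> q; eexists _, _; split; [exact: EPutR | |]. Qed.

Lemma runs_seq (R : realType) w c1 c2 (st : store R) T1 T2 (P Q : _ -> Prop) :
  runs w c1 st T1 P -> (forall st', P st' -> runs w c2 st' T2 Q) ->
  runs w (CSeq c1 c2) st (T1 + T2) Q.
Proof.
move=> [st1 [t1 [e1 le1 p1]]] /(_ _ p1)[st2 [t2 [e2 le2 q2]]].
by exists st2, (t1 + t2)%N; split=> //; [apply: ESeq e1 e2 | apply: leq_add].
Qed.

(** The invariant is indexed by the number of completed iterations, so it also serves as the
    termination measure; the induction is on the number of iterations left. The last summand of the
    budget pays for the final failing test. *)
Lemma runs_while (R : realType) w b c (Inv : nat -> store R -> Prop) N T st :
  Inv 0%N st ->
  (forall i st', (i < N)%N -> Inv i st' ->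
     beval w st' b /\ runs w c st' T (Inv i.+1)) ->
  (forall st', Inv N st' -> ~~ beval w st' b) ->
  runs w (CWhile b c) st (N * (T + bcost b).+1 + (bcost b).+1) (Inv N).
Proof.
move=> inv0 step stop.
suff gen m i st' : (i + m = N)%N -> Inv i st' ->
    runs w (CWhile b c) st' (m * (T + bcost b).+1 + (bcost b).+1) (Inv N).
  exact: gen inv0.
elim: m i st' => [|m IHm] i st' iN inv.
  have iNE : i = N by lia.
  exists st', (bcost b).+1; rewrite -iNE; split=> //.
  by apply: EWhileF; apply: stop; rewrite -iNE.
have [|bt [st1 [t1 [e1 le1 inv1]]]] := step i st' _ inv; first by lia.
have [|st2 [t2 [e2 le2 inv2]]] := IHm i.+1 st1 _ inv1; first by lia.
exists st2, (bcost b + t1 + t2).+1; split=> //; first exact: EWhileT e1 e2.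
rewrite mulSn; lia.
Qed.

(** Taking equality with the updated store as intermediate assertion turns straight-line code into
    symbolic execution. *)
Lemma runs_seq_setI (R : realType) w x e c (st : store R) T (Q : _ -> Prop) :
  runs w c (set_ivar st x (ieval w st e)) T Q ->
  runs w (CSeq (CSetI x e) c) st ((icost e).+1 + T) Q.
Proof.
move=> h; apply: (runs_seq (P := eq (set_ivar st x (ieval w st e)))) => [|_ <- //].
exact: runs_setI.
Qed.

Lemma runs_seq_setR (R : realType) w x e c (st : store R) T (Q : _ -> Prop) :
  runs w c (set_rvar st x (reval w st e)) T Q ->
  runs w (CSeq (CSetR x e) c) st ((rcost e).+1 + T) Q.
Proof.
move=> h; apply: (runs_seq (P := eq (set_rvar st x (reval w st e)))) => [|_ <- //].
exact: runs_setR.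
Qed.

(** * The two programs *)

Notation "c1 ;; c2" := (CSeq c1 c2)
  (at level 90, right associativity, only parsing).

(* Integer variables: 5 data vector, 6 entry, 7 exponent k, 8 base address j p
   of the current coordinate (in a query 5 is the entry).  Real variables:
   1 answer, 2 sum of the a_{j,0}, 3 running term, 4 the factor - x_j (y_j in a
   query).  Real array 2 is the table.  The preprocessing relies on integer
   variable 5 and real variable 2 being 0 initially. *)
Definition pre_coef_loop : cmd :=
  CWhile (BILt (ILit 0) (IVar 7))
   (CSetR 3 (RDiv (RMul (RMul (RVar 3) (RVar 4)) (RCast (IVar 7)))
                  (RCast (IAdd (ISub (IVar 3) (IVar 7)) (ILit 1)))) ;;
    CSetI 7 (ISub (IVar 7) (ILit 1)) ;;
    CPutR 2 (IAdd (IVar 8) (IVar 7))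
      (RAdd (RGet 2 (IAdd (IVar 8) (IVar 7))) (RVar 3))).

Definition pre_entry_loop : cmd :=
  let here := IAdd (IMul (IVar 5) (IVar 2)) (IVar 6) in
  CWhile (BILt (IVar 6) (IGet 0 (IVar 5)))
   (CSetI 8 (IMul (IGet 1 here) (IVar 3)) ;;
    CSetR 4 (RSub (RCast (ILit 0)) (RGet 0 here)) ;;
    CSetR 3 (RCast (ILit 1)) ;;
    CSetI 7 (IVar 3) ;;
    pre_coef_loop ;;
    CSetR 2 (RAdd (RVar 2) (RVar 3)) ;;
    CSetI 6 (IAdd (IVar 6) (ILit 1))).

Definition preprocess : cmd :=
  CWhile (BILt (IVar 5) (IVar 0))
   (CSetI 6 (ILit 0) ;;
    pre_entry_loop ;;
    CSetI 5 (IAdd (IVar 5) (ILit 1))).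

Definition qry_coef_loop : cmd :=
  CWhile (BILt (IVar 7) (IVar 3))
   (CSetR 1 (RAdd (RVar 1) (RMul (RGet 2 (IAdd (IVar 8) (IVar 7))) (RVar 3))) ;;
    CSetR 3 (RMul (RVar 3) (RVar 4)) ;;
    CSetI 7 (IAdd (IVar 7) (ILit 1))).

Definition qry_entry_loop : cmd :=
  CWhile (BILt (IVar 5) (IVar 4))
   (CSetI 8 (IMul (IGet 2 (IVar 5)) (IVar 3)) ;;
    CSetR 4 (RGet 1 (IVar 5)) ;;
    CSetR 3 (RVar 4) ;;
    CSetI 7 (ILit 1) ;;
    qry_coef_loop ;;
    CSetR 1 (RAdd (RVar 1) (RMul (RCast (IVar 0)) (RVar 3))) ;;
    CSetI 5 (IAdd (IVar 5) (ILit 1))).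

Definition query : cmd :=
  CSetR 1 (RVar 2) ;; CSetI 5 (ILit 0) ;; qry_entry_loop.

(** * Correctness and cost of the preprocessing *)

(** The part of the input that the preprocessing reads and never overwrites; every invariant carries
    it along. *)
Definition loaded (R : realType) (n d s p : nat) (X : seq 'rV[R]_d)
    (st : store R) : Prop :=
  [/\ ivar st 0 = n, ivar st 2 = s, ivar st 3 = p &
   forall i, (i < n)%N -> iarr st 0 i = size (supp (nth 0 X i)) /\
    forall j, (j < s)%N ->
      iarr st 1 (i * s + j) = supp_idx (nth 0 X i) j /\
      rarr st 0 (i * s + j) = supp_val (nth 0 X i) j].

Definition holds_table (R : realType) (d p : nat) (B : 'I_d -> nat -> R)
    (st : store R) : Prop :=
  forall (j : 'I_d) k, (k < p)%N -> rarr st 2 (j * p + k) = B j k.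

(** Distinct pairs (coordinate, degree) have distinct addresses, so a write to one table cell
    preserves all the others. *)
Lemma eq_mixed_radix (p a b i j : nat) : (i < p)%N -> (j < p)%N ->
  (a * p + i == b * p + j)%N = (a == b) && (i == j).
Proof.
move=> ip jp; apply/eqP/andP => [e|[/eqP-> /eqP->] //].
have p0 : (0 < p)%N by lia.
have := congr1 (divn^~ p) e; have := congr1 (modn^~ p) e.
by rewrite !modnMDl !divnMDl // !divn_small // !modn_small // !addn0 => -> ->.
Qed.

Lemma mixed_radix_lt (d p a i : nat) : (a < d)%N -> (i < p)%N ->
  (a * p + i < d * p)%N.
Proof.
move=> ad ip; apply: (@leq_trans (a.+1 * p)); first by rewrite mulSn addnC ltn_add2r.
by rewrite leq_mul2r ad orbT.
Qed.

Lemma modn_sub_small (m a b : nat) : (b <= a)%N -> (a < m)%N ->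
  ((a + m - b) %% m)%N = (a - b)%N.
Proof. by move=> ba am; rewrite addnC -addnBA // modnDl modn_small //; lia. Qed.

(** The prior table [B] is arbitrary, so that the contributions of successive entries accumulate.
    The running term ends as the degree 0 coefficient, which the caller adds to real variable 2. *)
Lemma pre_coef_loop_runs (R : realType) (n d s p w : nat) (X : seq 'rV[R]_d)
    (B : 'I_d -> nat -> R) (l : 'I_d) (v : R) (st : store R) :
  (1 < 2 ^ w)%N -> (p < 2 ^ w)%N -> (d * p <= 2 ^ w)%N ->
  loaded n s p X st -> holds_table p B st ->
  ivar st 7 = p -> ivar st 8 = (l * p)%N -> rvar st 4 = - v -> rvar st 3 = 1 ->
  runs w pre_coef_loop st (p * 40 + 4) (fun st' =>
    [/\ loaded n s p X st',
        holds_table p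
          (fun j k => B j k + (if j == l then shifted_coef p v k else 0)) st',
        rvar st' 3 = shifted_coef p v 0 &
        [/\ ivar st' 5 = ivar st 5, ivar st' 6 = ivar st 6
          & rvar st' 2 = rvar st 2]]).
Proof.
move=> w1 pw dpw ld tb i7 i8 r4 r3.
(* The degree descends: after [m] iterations it is [p - m], and exactly the cells of row [l] of
   degree at least [p - m] are updated. *)
pose Inv m st' := [/\ loaded n s p X st',
   holds_table p (fun j k => B j k +
     (if (j == l) && (p - m <= k)%N then shifted_coef p v k else 0)) st',
   rvar st' 3 = shifted_coef p v (p - m),
   [/\ ivar st' 5 = ivar st 5, ivar st' 6 = ivar st 6
     & rvar st' 2 = rvar st 2] &
   [/\ ivar st' 7 = (p - m)%N, ivar st' 8 = (l * p)%N & rvar st' 4 = - v]].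
apply: (@runs_weaken _ _ _ _ _ _ (Inv p)).
- apply: (@runs_while _ _ _ _ Inv p 35).
  + split=> //; [move=> j k kp | by rewrite subn0 shifted_coefpp | by rewrite subn0].
    by rewrite subn0 leqNgt kp andbF addr0 tb.
  + move=> m st1 mp [ld1 tb1 r31 fr1 [i71 i81 r41]]; split.
      by rewrite /= mod0n i71 subn_gt0.
    have [_ _ i31 _] := ld1.
    have k1 : (p - m = (p - m.+1).+1)%N by lia.
    have k2 : (p - m.+1 < p)%N by lia.
    move E : (p - m.+1)%N k1 k2 => k k1 kp; rewrite k1 in i71 r31 tb1.
    eapply runs_weaken.
    * apply: runs_seq_setR; apply: runs_seq_setI; apply: runs_putR.
      exact: erefl.
    * by [].
    move=> _ <- /=.
    rewrite /upd /= i71 i31 i81 r31 r41 (modn_small w1) !modn_sub_small //;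
      [|lia..].
    (* Variable 7 still holds [k.+1] when the program divides, so its divisor is the [p - k] of
       [shifted_coefS]. *)
    rewrite (_ : p - k.+1 + 1 = p - k)%N; last lia.
    rewrite subn1 /= (@modn_small (p - k)); last lia.
    rewrite (@modn_small (l * p + k)); last first.
      by apply: leq_trans dpw; apply: mixed_radix_lt.
    rewrite -shifted_coefS // tb1 // ltnn andbF addr0 /Inv E.
    split=> // j k' k'p; rewrite /= /upd2 /upd /= eq_mixed_radix //.
    rewrite tb1 // val_eqE; case: (eqVneq j l) => [->|_] //=.
    by case: (ltngtP k' k) => // ->.
  + by move=> st1 [_ _ _ _ [i71 _ _]]; rewrite /= mod0n i71 subnn.
- by rewrite /=; lia.
- move=> st1 [ld1 tb1 r31 fr1 _]; rewrite subnn in r31; split=> // j k kp.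
  by rewrite tb1 // subnn andbT.
Qed.

(** Ties the arrays read at entry [q] to the growth of the processed prefix of the support, over
    which the loop invariants sum. *)
Lemma nth_supp (R : realType) (d : nat) (v : 'rV[R]_d) (q : nat) :
  (q < size (supp v))%N ->
  exists l : 'I_d, [/\ take q.+1 (supp v) = rcons (take q (supp v)) l,
    supp_idx v q = l & supp_val v q = v 0 l].
Proof.
rewrite /supp_idx /supp_val; case: (supp v) => // l0 s qs.
exists (nth l0 (l0 :: s) q); split; first exact: take_nth.
  by rewrite (nth_map l0).
by rewrite (nth_map l0).
Qed.

Lemma pre_entry_loop_runs (R : realType) (n d s p w i : nat)
    (X : seq 'rV[R]_d) (B : 'I_d -> nat -> R) (T : R) (st : store R) :
  (0 < p)%N -> (1 < 2 ^ w)%N -> (p < 2 ^ w)%N -> (d * p <= 2 ^ w)%N ->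
  (n * s <= 2 ^ w)%N -> (s < 2 ^ w)%N -> (i < n)%N ->
  sparse s (nth 0 X i) ->
  loaded n s p X st -> holds_table p B st -> rvar st 2 = T ->
  ivar st 5 = i -> ivar st 6 = 0%N ->
  runs w pre_entry_loop st (s * (p * 40 + 60) + 5) (fun st' =>
    [/\ loaded n s p X st',
        holds_table p (fun j k => B j k + shifted_coef p (nth 0 X i 0 j) k) st',
        rvar st' 2 = T + \sum_(j < d) shifted_coef p (nth 0 X i 0 j) 0 &
        ivar st' 5 = i]).
Proof.
move=> p0 w1 pw dpw nsw sw iltn; set x := nth 0 X i => sp ld tb r2 i5 i6.
pose N := size (supp x).
pose Inv q st' := [/\ loaded n s p X st',
   holds_table p (fun j k => B j k +
     \sum_(l <- take q (supp x) | l == j) shifted_coef p (x 0 l) k) st',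
   rvar st' 2 = T + \sum_(l <- take q (supp x)) shifted_coef p (x 0 l) 0,
   ivar st' 5 = i & ivar st' 6 = q].
apply: (@runs_weaken _ _ _ _ _ _ (Inv N)).
- apply: (@runs_while _ _ _ _ Inv N (p * 40 + 50)).
  + split=> //; last by rewrite take0 big_nil addr0.
    by move=> j k kp; rewrite take0 big_nil addr0 tb.
  + move=> q st1 qN [ld1 tb1 r21 i51 i61].
    have [_ i21 i31 /(_ _ iltn)[a01 aj1]] := ld1.
    have qs : (q < s)%N by apply: leq_trans sp.
    have [a11 b01] := aj1 _ qs.
    split; first by rewrite /= i61 i51 a01.
    have [l [tkq idxq valq]] := nth_supp qN.
    (* The address does not wrap around, being below $n s \le 2^w$. *)
    have here : (((i * s) %% 2 ^ w + q) %% 2 ^ w)%N = (i * s + q)%N.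
      have h := mixed_radix_lt iltn qs.
      by rewrite !modn_small; lia.
    have lpw : (l * p < 2 ^ w)%N.
      by apply: leq_trans dpw; rewrite -[(l * p)%N]addn0 mixed_radix_lt.
    eapply (@runs_weaken _ _ _ _ _ _ (Inv q.+1)).
    * do 4!(first [apply: runs_seq_setI | apply: runs_seq_setR]).
      rewrite /= /upd /= i51 i21 i61 i31 here a11 b01 idxq valq.
      rewrite (modn_small w1) (modn_small lpw) mod0n sub0r.
      apply: runs_seq; first 
        by apply: (@pre_coef_loop_runs _ n d s p w X _ l (x 0 l) _ w1 pw dpw);
          [exact: ld1 | exact: tb1 | ..].
      move=> st2 [ld2 tb2 r32 [i52 i62 r22]].
      rewrite /= /upd /= ?i51 ?i61 ?r21 in i52 i62 r22.
      apply: runs_seq_setR; apply: runs_setI.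
      rewrite /= /upd /= i62 (modn_small w1) modn_small ?addn1; last lia.
      split=> //.
        move=> j k kp; rewrite [LHS]tb2 //= -addrA; congr (_ + _).
        by rewrite tkq -cats1 big_cat big_mkcond /= -big_mkcond big_cons big_nil
          eq_sym; case: ifP; rewrite ?addr0.
      by rewrite /= /upd /= r22 r32 tkq -cats1 big_cat big_seq1 addrA.
    * by rewrite /=; lia.
    * by [].
  + by move=> st1 [ld1 _ _ i51 i61]; have [_ _ _ /(_ _ iltn)[a01 _]] := ld1;
      rewrite /= i51 i61 a01 ltnn.
- rewrite /=; have : (N * (p * 40 + 57) <= s * (p * 40 + 57))%N by rewrite leq_mul2r sp orbT.
  lia.
- move=> st1 [ld1 tb1 r21 i51 _]; rewrite take_size in r21 tb1.
  split=> // [j k kp|].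
    rewrite tb1 //; congr (_ + _).
    (* For degrees below $p$ a zero coordinate contributes 0, so the sum extends from the support to
       all coordinates, and the filter keeps the single index [j]. *)
    rewrite big_mkcond big_supp /=; last first.
      by move=> a ->; rewrite shifted_coef_at0 // if_same.
    by rewrite -big_mkcond big_pred1_eq.
  by rewrite r21 big_supp // => j ->; rewrite shifted_coef_at0.
Qed.

Lemma loaded_init (R : realType) (n d s p : nat) (eps : R)
    (X : n.-tuple 'rV[R]_d) (r : seq nat) :
  loaded n s p X (init_store s p eps X r).
Proof.
split=> // i _; split=> // j js; have s0 : (0 < s)%N by lia.
by rewrite /= divnMDl // divn_small // addn0 modnMDl modn_small.
Qed.

Lemma preprocess_runs (R : realType) (n d s p w : nat) (eps : R)
    (X : n.-tuple 'rV[R]_d) (r : seq nat) :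
  (0 < p)%N -> (1 < 2 ^ w)%N -> (p < 2 ^ w)%N -> (d * p <= 2 ^ w)%N ->
  (n * s <= 2 ^ w)%N -> (s < 2 ^ w)%N -> (n < 2 ^ w)%N ->
  (forall x, x \in X -> sparse s x) ->
  runs w preprocess (init_store s p eps X r) (n * (s * (p * 40 + 60) + 20) + 4)
    (fun st => [/\ loaded n s p X st, holds_table p (table p X) st
                 & rvar st 2 = power_total p X]).
Proof.
move=> p0 w1 pw dpw nsw sw nw spX.
pose Inv i (st : store R) := [/\ loaded n s p X st,
  holds_table p (table p (take i X)) st, rvar st 2 = power_total p (take i X)
  & ivar st 5 = i].
apply: (@runs_weaken _ _ _ _ _ _ (Inv n)).
- apply: (@runs_while _ _ _ _ Inv n (s * (p * 40 + 60) + 15)).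
  + split=> //; first exact: loaded_init.
      (* Zeroed memory is already the table of the empty dataset. *)
      by move=> j k kp; rewrite take0 /table big_nil.
    by rewrite take0 /power_total big_nil.
  + move=> i st iltn [ld tb r2 i5]; have [i0 _ _ _] := ld.
    split; first by rewrite /= i0 i5.
    have iX : (i < size X)%N by rewrite size_tuple.
    eapply (@runs_weaken _ _ _ _ _ _ (Inv i.+1)).
    * apply: runs_seq_setI; rewrite /= mod0n.
      apply: runs_seq.
        by apply: (@pre_entry_loop_runs _ n d s p w i X (table p (take i X))
          (power_total p (take i X)) _ p0 w1 pw dpw nsw sw iltn) => //;
          apply/spX/mem_nth.
      move=> st2 [ld2 tb2 r22 i52]; apply: runs_setI.
      rewrite /= i52 (modn_small w1) modn_small ?addn1; last lia.
      split=> //.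
        move=> j k kp; rewrite [LHS]tb2 // (take_nth 0) // /table.
        by rewrite -cats1 big_cat big_seq1.
      by rewrite /= r22 (take_nth 0) // /power_total -cats1 big_cat big_seq1.
    * by rewrite /=; lia.
    * by [].
  + by move=> st [[i0 _ _ _] _ _ i5]; rewrite /= i0 i5 ltnn.
- by rewrite /=; lia.
- by move=> st [ld tb r2 _]; rewrite take_oversize ?size_tuple in tb r2 *.
Qed.

(** * Correctness and cost of a query *)

Definition query_ready (R : realType) (n d p : nat) (B : 'I_d -> nat -> R)
    (T : R) (y : 'rV[R]_d) (st : store R) : Prop :=
  [/\ [/\ ivar st 0 = n, ivar st 3 = p & ivar st 4 = size (supp y)],
      holds_table p B st, rvar st 2 = T &
      iarr st 2 = supp_idx y /\ rarr st 1 = supp_val y].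

Lemma qry_coef_loop_runs (R : realType) (n d p w : nat) (B : 'I_d -> nat -> R)
    (T : R) (y : 'rV[R]_d) (l : 'I_d) (a v : R) (st : store R) :
  (0 < p)%N -> (1 < 2 ^ w)%N -> (p < 2 ^ w)%N -> (d * p <= 2 ^ w)%N ->
  query_ready n p B T y st ->
  ivar st 7 = 1%N -> ivar st 8 = (l * p)%N ->
  rvar st 1 = a -> rvar st 3 = v -> rvar st 4 = v ->
  runs w qry_coef_loop st (p * 30 + 4) (fun st' =>
    [/\ query_ready n p B T y st',
        rvar st' 1 = a + \sum_(1 <= k < p) B l k * v ^+ k,
        rvar st' 3 = v ^+ p & ivar st' 5 = ivar st 5]).
Proof.
move=> p0 w1 pw dpw qr i7 i8 r1 r3 r4.
(* Degrees run upwards from 1, hence the shift to [m.+1] and only [p.-1] iterations. The running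
   term is left at $v^p$, which the caller multiplies by $n$. *)
pose Inv m st' := [/\ query_ready n p B T y st',
   rvar st' 1 = a + \sum_(1 <= k < m.+1) B l k * v ^+ k,
   rvar st' 3 = v ^+ m.+1, ivar st' 5 = ivar st 5 &
   [/\ ivar st' 7 = m.+1, ivar st' 8 = (l * p)%N & rvar st' 4 = v]].
apply: (@runs_weaken _ _ _ _ _ _ (Inv p.-1)).
- apply: (@runs_while _ _ _ _ Inv p.-1 24).
  + by split=> //; rewrite big_geq // addr0.
  + move=> m st1 mp [qr1 r11 r31 i51 [i71 i81 r41]].
    have [[_ i31 _] tb1 _ _] := qr1; have m1p : (m.+1 < p)%N by lia.
    split; first by rewrite /= i71 i31.
    eapply runs_weaken.
    * apply: runs_seq_setR; apply: runs_seq_setR; apply: runs_setI.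
      exact: erefl.
    * by [].
    move=> _ <- /=; rewrite /upd /= i71 i81 r11 r31 r41 (modn_small w1).
    rewrite (@modn_small (l * p + _)); last first.
      by apply: leq_trans dpw; apply: mixed_radix_lt.
    rewrite tb1 // modn_small ?addn1; last lia.
    split=> //; first by rewrite /= /upd /= [in RHS]big_nat_recr //= addrA.
    by rewrite /= /upd /= -exprSr.
  + by move=> st1 [[[_ i31 _] _ _ _] _ _ _ [i71 _ _]]; rewrite /= i71 i31 prednK // ltnn.
- by rewrite /=; lia.
- by move=> st1 [qr1 r11 r31 i51 _]; rewrite prednK // in r11 r31.
Qed.

Lemma query_runs (R : realType) (n d s p w : nat) (X : seq 'rV[R]_d)
    (y : 'rV[R]_d) (D : store R) :
  (0 < p)%N -> (1 < 2 ^ w)%N -> (p < 2 ^ w)%N -> (d * p <= 2 ^ w)%N ->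
  (s < 2 ^ w)%N -> size X = n -> sparse s y ->
  loaded n s p X D -> holds_table p (table p X) D ->
  rvar D 2 = power_total p X ->
  runs w query (load_query D y) (s * (p * 30 + 50) + 20) (fun st =>
    answer st = power_total p X + \sum_(j <- supp y) query_term p X y j).
Proof.
move=> p0 w1 pw dpw sw sizeX spy ld tb r2.
pose N := size (supp y).
pose Inv q st := [/\ query_ready n p (table p X) (power_total p X) y st,
  rvar st 1 = power_total p X + \sum_(j <- take q (supp y)) query_term p X y j
  & ivar st 5 = q].
eapply runs_weaken.
- apply: runs_seq_setR; apply: runs_seq_setI.
  apply: (@runs_while _ _ _ _ Inv N (p * 30 + 40)).
  (* Loading the query changes only integer variable 4, integer array 2, real array 1 and the tape,
     so the table in real array 2 and the total in real variable 2 survive. *)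
  + have [i0 _ i3 _] := ld; rewrite /= mod0n; split=> //.
    by rewrite take0 big_nil addr0.
  + move=> q st1 qN [qr1 r11 i51].
    have [[i01 i31 i41] _ _ [ia ra]] := qr1.
    have qs : (q < s)%N by apply: leq_trans spy.
    split; first by rewrite /= i51 i41.
    have [l [tkq idxq valq]] := nth_supp qN.
    have lpw : (l * p < 2 ^ w)%N.
      by apply: leq_trans dpw; rewrite -[(l * p)%N]addn0 mixed_radix_lt.
    eapply (@runs_weaken _ _ _ _ _ _ (Inv q.+1)).
    * do 4!(first [apply: runs_seq_setI | apply: runs_seq_setR]).
      rewrite /= /upd /= i51 i31 ia ra idxq valq.
      rewrite (modn_small w1) (modn_small lpw).
      apply: runs_seq.
        by apply: (@qry_coef_loop_runs _ n d p w (table p X) (power_total p X)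
          y l _ (y 0 l) _ p0 w1 pw dpw).
      move=> st2 [qr2 r12 r32 i52]; have [[i02 _ _] _ _ _] := qr2.
      rewrite /= /upd /= ?i51 ?r11 in r12 i52.
      apply: runs_seq_setR; apply: runs_setI.
      rewrite /= /upd /= i52 r12 r32 i02 (modn_small w1) modn_small ?addn1; last lia.
      split=> //; rewrite /= /upd /= tkq -cats1 big_cat big_seq1 /query_term sizeX.
      by rewrite !addrA.
    * by rewrite /=; lia.
    * by [].
  + by move=> st1 [[[_ _ i41] _ _ _] _ i51]; rewrite /= i51 i41 ltnn.
- rewrite /=.
  have : (N * (p * 30 + 45) <= s * (p * 30 + 45))%N by rewrite leq_mul2r spy orbT.
  lia.
- by move=> st1 [_ r11 _]; rewrite take_size in r11.
Qed.

(** * Numeric bounds and the final assembly *)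

(** This is $\ln(1+x) \le x$ at $x = -1/2$. *)
Lemma ln2_ge (R : realType) : 2^-1 <= ln 2 :> R.
Proof.
have := @le_ln1Dx R (- 2^-1).
have -> : 1 + - 2^-1 = 2^-1 :> R by field.
rewrite lnV ?posrE ?ltr0n //; lra.
Qed.

(** Since $\ln n \ge 1/2$ and $1/\varepsilon^2 \ge 1$, doubling the constant absorbs both factors.
    The parameter [a] is $n$ for the preprocessing and 1 for a query. *)
Lemma nat_le_budget (R : realType) (a n p s t : nat) (eps : R) :
  (1 < n)%N -> 0 < eps < 1 -> (t <= 200 * (a * (p * s)))%N ->
  t%:R <= 400 * (a%:R * ln n%:R * p%:R * s%:R / eps ^+ 2).
Proof.
move=> n1 /andP[e0 e1] tle.
have lnn : 2^-1 <= ln n%:R :> R.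
  by apply: le_trans (ln2_ge R) _; rewrite ler_ln ?posrE ?ltr0n ?ler_nat //; lia.
have e2 : 1 <= (eps ^+ 2)^-1.
  by rewrite invf_ge1 ?exprn_gt0 // exprn_ile1 // ltW.
have m0 : 0 <= (a * (p * s))%:R :> R by [].
have : t%:R <= 200 * (a * (p * s))%:R :> R by rewrite -natrM ler_nat.
have -> : a%:R * ln n%:R * p%:R * s%:R / eps ^+ 2
   = (a * (p * s))%:R * (ln n%:R * (eps ^+ 2)^-1) by rewrite !natrM; ring.
have : 2^-1 <= ln n%:R * (eps ^+ 2)^-1 by nra.
by move: (_ * _^-1) (_%:R) m0 => u m m0 hu ht; nra.
Qed.

Lemma unif_prob_true (R : realType) (w l : nat) (E : pred (coins w l)) :
  (forall r, E r) -> unif_prob R E = 1.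
Proof.
move=> ET; rewrite /unif_prob (eq_card (B := predT)) => [|r]; last exact: ET.
rewrite divff // pnatr_eq0 card_tuple card_ord.
by rewrite -lt0n !expn_gt0.
Qed.

Theorem mainTheorem18 (R : realType) :
  exists (Pre Qry : cmd) (C c : R) (K : nat),
    [/\ 0 < C, 0 < c &
    forall (n d s p : nat) (eps : R) (X : n.-tuple 'rV[R]_d) (w l : nat),
      (1 < n)%N -> (0 < s)%N -> (0 < p)%N -> ~~ odd p ->
      0 < eps < 1 ->
      (forall x, x \in X -> nonneg x /\ sparse s x) ->
      ((n + d + s + p)%:R + eps^-1) ^+ K <= (2 ^ w)%:R :> R ->
      let Tpre : R := C * (n%:R * ln n%:R * p%:R * s%:R / eps ^+ 2) in
      let Tqry : R := C * (ln n%:R * p%:R * s%:R / eps ^+ 2) in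
      Tpre <= l%:R ->
      exists D : coins w l -> store R,
        (forall r : coins w l, exists2 tpre : nat,
            exec w Pre (init_store s p eps X (words r)) (D r) tpre &
            tpre%:R <= Tpre) /\
        (forall y : 'rV[R]_d, nonneg y -> sparse s y ->
           exists t : coins w l -> R,
             (forall r : coins w l, exists (st : store R) (tqry : nat),
                [/\ exec w Qry (load_query (D r) y) st tqry,
                    tqry%:R <= Tqry & answer st = t r]) /\
             let S : R := \sum_(x <- X) pnorm p (x - y) ^+ p in
             1 - n%:R `^ (- c)
               <= unif_prob R [pred r : coins w l | `|t r - S| <= eps * S])].
Proof.
(* The constant 400 comes from [nat_le_budget]. The success probability is 1, so any positive [c]
   would do. The exponent 2 makes words large enough for the products $dp$ and $ns$ that bound the
   addresses. *)
exists preprocess, query, 400, 1, 2%N; split=> //.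
move=> n d s p eps X w l n1 s0 p0 p_even eps01 dataX wbound Tpre Tqry _.
have /andP[e0 e1] := eps01.
(* The successor comes from $1/\varepsilon \ge 1$. *)
have bound : ((n + d + s + p).+1 ^ 2 <= 2 ^ w)%N.
  rewrite -(ler_nat R); apply: le_trans wbound; rewrite natrX.
  have h : (n + d + s + p).+1%:R <= (n + d + s + p)%:R + eps^-1.
    by rewrite -[X in X <= _]natr1 lerD2l invf_ge1 // ltW.
  by rewrite lerXn2r ?nnegrE ?(le_trans _ h).
have [w1 pw sw nw] : [/\ 1 < 2 ^ w, p < 2 ^ w, s < 2 ^ w & n < 2 ^ w]%N.
  by split; apply: leq_trans bound; rewrite expnS expn1; nia.
have [dpw nsw] : (d * p <= 2 ^ w /\ n * s <= 2 ^ w)%N.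
  by split; apply: leq_trans bound; rewrite expnS expn1; nia.
have ps0 : (0 < p * s)%N by rewrite muln_gt0 p0.
have spX x : x \in X -> sparse s x by case/dataX.
have /choice[D preD] : forall r : coins w l, exists st, exists2 t : nat,
    exec w preprocess (init_store s p eps X (words r)) st t &
    t%:R <= Tpre /\ [/\ loaded n s p X st, holds_table p (table p X) st
                 & rvar st 2 = power_total p X].
  move=> r.
  have [st [t [e tle q]]] :=
    preprocess_runs eps (words r) p0 w1 pw dpw nsw sw nw spX.
  exists st, t => //; split=> //; apply: nat_le_budget => //.
  (* As $n, p, s \ge 1$, the budget is at most $(40+60+20+4)\,nps \le 200\,nps$. *)
  by apply: leq_trans tle _; nia.
exists D; split=> [r|y _ spy].
  by have [t e [tle _]] := preD r; exists t.
(* The answer is the exact sum, whatever the tape. *)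
exists (fun _ => \sum_(x <- X) pnorm p (x - y) ^+ p); split=> [r|S].
  have [_ _ [_ [ld tb r2]]] := preD r.
  have [st [t [e tle q]]] := query_runs p0 w1 pw dpw sw (size_tuple X) spy ld tb r2.
  exists st, t; split=> //; last by rewrite q sum_pnormX.
  rewrite /Tqry -[ln _]mul1r; apply: (@nat_le_budget _ 1) => //.
  by apply: leq_trans tle _; nia.
rewrite unif_prob_true; first by rewrite gerBl powR_ge0.
move=> r /=; rewrite subrr normr0 mulr_ge0 ?(ltW e0) //.
by apply: sumr_ge0 => x _; rewrite exprn_ge0 // powR_ge0.
Qed.
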